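(* Let $Z$ be a random variable with mean $0$ and variance $1$ whose distribution is unimodal. For any $v\geq 0$ the inequality $$P(Z\geq v)\leq \begin{cases} \dfrac{3-v^2}{3(1+v^2)}, & 0\leq v\leq \sqrt{\tfrac53},\\[2mm] \dfrac49\,\dfrac{1}{1+v^2}, & \sqrt{\tfrac53}\leq v,\end{cases}$$ holds. For $0<v\leq\sqrt{5/3}$ equality holds if $Z$ has mass $(3-v^2)/(3(1+v^2))$ at $v$ and the rest of its mass, $4v^2/(3(1+v^2))$, uniformly distributed on the interval $[-(3+v^2)/(2v),\,v]$. For $\sqrt{5/3}\leq v$ equality holds if $Z$ has mass $(3v^2-1)/(3(1+v^2))$ at $-1/v$ and the rest of its mass, $4/(3(1+v^2))$, uniformly distributed on the interval $[-1/v,\,(1+3v^2)/(2v)]$.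
   Context: A distribution on $\mathbb{R}$ is unimodal with mode at $M$ if its distribution function is convex on $(-\infty,M)$ and concave on $[M,\infty)$; it is unimodal if this holds for some real $M$. (A unimodal distribution may thus have an atom, but only at the mode $M$.) *)

(* Defs.v *)
From HB Require Import structures.
From mathcomp Require Import all_boot all_order all_algebra.
From mathcomp Require Import all_classical all_reals all_analysis.
Import Order.TTheory GRing.Theory Num.Theory.
Import numFieldNormedType.Exports.

Set Implicit Arguments.
Unset Strict Implicit.
Unset Printing Implicit Defensive.

Local Open Scope classical_set_scope.
Local Open Scope ring_scope.

Definition concave_function (R : numFieldType) (D : set R) (F : R -> R) : Prop :=
  @convex_function R R^o D (fun x => - F x).

(* The first set is open at M: a jump of the distribution function (an atom) is
   thus possible at M, and nowhere else. *)
Definition unimodal_at (R : realType) (F : R -> R) (M : R) : Prop :=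
  @convex_function R R^o `]-oo, M[ F /\ concave_function `[M, +oo[ F.

Definition unimodal (R : realType) d (T : measurableType d)
    (P : probability T R) (X : {RV P >-> R}) : Prop :=
  exists M : R, unimodal_at (fun x => fine (cdf X x)) M.

(* Mass p at the point c and mass q spread uniformly over [a, b]; the proof that
   a < b is only needed to name the library's uniform probability. *)
Definition atom_plus_uniform (R : realType) d (T : measurableType d)
    (P : probability T R) (X : {RV P >-> R}) (p c q a b : R) : Prop :=
  exists ab : a < b, forall A : set R, measurable A ->
    distribution P X A = (p%:E * \d_c A + q%:E * uniform_prob ab A)%E.

(* The finiteness of the first two moments is part of the equations: the
   extended-real integral of a function whose positive or negative part has
   infinite integral is infinite. *)
Definition standardized (R : realType) d (T : measurableType d)
    (P : probability T R) (X : {RV P >-> R}) : Prop :=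
  ('E_P[X] = 0 /\ 'V_P[X] = 1)%E.

(* Main.v *)
Require Import Defs.
From HB Require Import structures.
From mathcomp Require Import all_boot all_order all_algebra.
From mathcomp Require Import all_classical all_reals all_analysis.
From mathcomp Require Import measurable_realfun ring lra.
Import Order.TTheory GRing.Theory Num.Theory.
Import numFieldNormedType.Exports.

Set Implicit Arguments.
Unset Strict Implicit.
Unset Printing Implicit Defensive.

Local Open Scope classical_set_scope.
Local Open Scope ring_scope.

(** The bound is the one-sided Vysochanskii-Petunin inequality for [Z + 1/v] at
    the level [r = v + 1/v].  As for Cantelli's inequality, the shift [c = 1/v]
    minimizes [(1 + c^2) / (v + c)^2], the second moment of [Z + c] divided by
    the square of the level; the minimum is [1 / (1 + v^2)].

    Let a distribution have mode [M], second moment [S] and upper tail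
    [p = m[r, oo[], and let [b] be [M] clamped to [0, r].  Everything follows
    from
        [b^2 + (9 r^2 - 6 b^2) p <= 4 S],
    which interpolates between [9 r^2 p <= 4 S] (Gauss, mode on the left of 0)
    and [r^2 (1 + 3 p) <= 4 S] (mode on the right of [r]).  It is the sum of two
    estimates ([second_moment_below_mode] and [second_moment_above_mode]), one
    for each side of [b].  Each says that [x^2] minus a step function has a
    nonnegative integral.  That difference is negative on some interval next to
    another one on which it is positive.  If [K] is the density at the point
    between them, unimodality makes the density at most [K] on the former and
    at least [K] on the latter, so replacing it by [K] does not increase the
    integral, and what remains is the integral of a quadratic polynomial.

    No density is needed: convexity of the distribution function gives [K] as a
    subgradient ([convex_function_subgradient]), and a bound on the increments
    of a distribution function passes to integrals because a Lebesgue-Stieltjes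
    measure is an infimum over covers by half-open intervals
    ([le_measure_lebesgue_stieltjes]).

    For the extremal distributions, standardization is read off from
    [E (Z + k)^2 = 1 + k^2] for all [k], which involves only integrals of
    nonnegative functions; unimodality is seen on the distribution function, an
    explicit ramp plus a jump. *)

(** * Comparison with Lebesgue-Stieltjes measures *)

Section domination.
Variable R : realType.
Local Open Scope ereal_scope.
Let RR := measurableTypeR R.

(** Since [lebesgue_stieltjes_measure f A] is the infimum of
    [\sum_k (f (b k) - f (a k))] over the covers of [A] by intervals
    [`]a k, b k]], a comparison on intervals is preserved by countable
    subadditivity of [m].  Two scalars appear because Lebesgue measure has to be
    used both as the smaller and as the larger of the two measures. *)
Lemma le_measure_lebesgue_stieltjes (m : {measure set RR -> \bar R})
    (f : cumulative R R) (K1 K2 : R) (D : set RR) :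
  (0 <= K1)%R -> (0 <= K2)%R -> measurable D ->
  (forall x y : R, (x < y)%R ->
     K1%:E * m ([set` `]x, y]] `&` D) <= K2%:E * (f y - f x)%:E) ->
  forall A : set RR, measurable A ->
  K1%:E * m (A `&` D) <= K2%:E * lebesgue_stieltjes_measure f A.
Proof.
move=> K10 K20 mD itvle A mA.
have cover_le (F : nat -> set (ocitv_type R)) :
    @measurable_cover _ (ocitv_type R) A F ->
    K1%:E * m (A `&` D) <= K2%:E * \sum_(k <oo) wlength f (F k).
  move=> [mF AF]; have {}mF k : ocitv (F k) := mF k.
  have mFR k : measurable (F k : set RR).
    by have [[a b] _ <-] := mF k; exact: measurable_itv.
  apply: (@le_trans _ _ (K1%:E * \sum_(k <oo) m (F k `&` D))).
    apply: lee_wpmul2l; first by rewrite lee_fin.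
    apply: measure_sigma_subadditive => [k||].
    - exact: measurableI.
    - exact: measurableI.
    - move=> x [Ax Dx]; have [k _ Fkx] := AF _ Ax.
      by exists k.
  rewrite -nneseriesZl; last by move=> k _; exact: measure_ge0.
  rewrite -nneseriesZl; last by move=> k _; exact: wlength_ge0.
  apply: lee_nneseries => k _; first by rewrite mule_ge0.
  have [[a b] /= _ <-] := mF k.
  have [ab|ba] := ltP a b.
    by rewrite wlength_itv_bnd ?(ltW ab)//; exact: itvle.
  by rewrite set_itv_ge ?bnd_simp -?leNgt// set0I measure0 wlength0 !mule0.
rewrite /lebesgue_stieltjes_measure /measure_extension /mu_ext.
move: K20; rewrite le_eqVlt => /predU1P[K2E|K2gt0].
  (* the left-hand side vanishes as soon as one cover exists *)
  rewrite -K2E mul0e.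
  have [F TF mF] := wlength_sigma_finite f.
  have /cover_le : @measurable_cover _ (ocitv_type R) A F.
    by split => [k|]; [exact: (mF k).1|rewrite -TF].
  by rewrite -K2E mul0e.
rewrite -lee_pdivrMl//; apply: le_ereal_inf_tmp => _ [F AF <-].
by rewrite lee_pdivrMl//; exact: cover_le.
Qed.

Lemma ge0_le_integral_lebesgue_stieltjes (m : {measure set RR -> \bar R})
    (f : cumulative R R) (K1 K2 : R) (D : set RR) (g : RR -> R) :
  (0 <= K1)%R -> (0 <= K2)%R -> measurable D ->
  (forall x y : R, (x < y)%R ->
     K1%:E * m ([set` `]x, y]] `&` D) <= K2%:E * (f y - f x)%:E) ->
  measurable_fun D g -> (forall x, D x -> (0 <= g x)%R) ->
  K1%:E * \int[m]_(x in D) (g x)%:E <=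
  K2%:E * \int[lebesgue_stieltjes_measure f]_(x in D) (g x)%:E.
Proof.
move=> K10 K20 mD itvle mg g0.
pose m1 := mscale (NngNum K10) (mrestr m mD).
pose m2 := mscale (NngNum K20) (lebesgue_stieltjes_measure f).
have -> : K1%:E * \int[m]_(x in D) (g x)%:E = \int[m1]_(x in D) (g x)%:E.
  rewrite ge0_integral_mscale//; last exact/measurable_EFinP.
  congr (_ * _); apply: eq_measure_integral => A mA AD.
  by rewrite /= /mrestr setIidl.
have -> : K2%:E * \int[lebesgue_stieltjes_measure f]_(x in D) (g x)%:E =
    \int[m2]_(x in D) (g x)%:E.
  by rewrite ge0_integral_mscale//; last exact/measurable_EFinP.
rewrite integral_mkcond [leRHS]integral_mkcond.
apply: ge0_le_measure_integral => //.
- move=> S mS; rewrite /m1 /m2 /mscale /mrestr /=.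
  exact: (le_measure_lebesgue_stieltjes (f := f) K10 K20 mD itvle).
- by apply: erestrict_ge0 => x Dx; rewrite lee_fin g0.
- by apply/(measurable_restrictT _ mD); exact/measurable_EFinP.
Qed.
End domination.

(** * Subgradients of convex functions *)

Section slopes.
Variable R : realType.

Lemma convex_functionE (D : set R) (F : R -> R) :
  @convex_function R R^o D F <->
  forall t x y : R, 0 <= t -> t <= 1 -> D x -> D y ->
    F (t * x + (1 - t) * y) <= t * F x + (1 - t) * F y.
Proof.
split=> [cF t x y t0 t1 Dx Dy|cF t x y /set_mem Dx /set_mem Dy].
  exact: (cF (Itv01 t0 t1) x y (mem_set Dx) (mem_set Dy)).
exact: cF.
Qed.

Lemma convex_function_slope (D : set R) (F : R -> R) (x y z : R) :
  @convex_function R R^o D F -> D x -> D z -> x < y -> y < z ->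
  (F y - F x) * (z - y) <= (F z - F y) * (y - x).
Proof.
move=> cF Dx Dz xy yz.
have xz : 0 < z - x by rewrite subr_gt0 (lt_trans xy).
have t01 : 0 <= (z - y) / (z - x) <= 1.
  by rewrite divr_ge0 ?ler_pdivrMr ?mul1r//=; lra.
have [t0 t1] := andP t01.
have /convex_functionE/(_ _ _ _ t0 t1 Dx Dz) := cF.
have -> : (z - y) / (z - x) * x + (1 - (z - y) / (z - x)) * z = y.
  by field; rewrite gt_eqF.
rewrite -(ler_pM2l xz).
have -> : (z - x) * ((z - y) / (z - x) * F x + (1 - (z - y) / (z - x)) * F z) =
  (z - y) * F x + (y - x) * F z by field; rewrite gt_eqF.
nra.
Qed.

(** [K] is the supremum of the slopes of the chords that end at [c]; it exists
    because every chord that starts at [c] is at least as steep.  It plays the role of the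
    density at [c], where [F] need not be differentiable. *)
Lemma convex_function_subgradient (D : set R) (F : R -> R) (a0 c b0 : R) :
  @convex_function R R^o D F -> D a0 -> D b0 -> D c -> a0 < c -> c < b0 ->
  exists K : R,
    (forall a b, D a -> D b -> a <= b -> b <= c -> F b - F a <= K * (b - a)) /\
    (forall a b, D a -> D b -> c <= a -> a <= b -> K * (b - a) <= F b - F a).
Proof.
move=> cF Da0 Db0 Dc a0c cb0.
pose S : set R := [set s | exists2 a, D a /\ a < c & s = (F c - F a) / (c - a)].
have slope_ub b : D b -> c < b -> ubound S ((F b - F c) / (b - c)).
  move=> Db cb _ [a [Da ac] ->].
  have := convex_function_slope cF Da Db ac cb.
  by rewrite ler_pdivrMr ?subr_gt0// mulrAC ler_pdivlMr ?subr_gt0.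
have S0 : S !=set0 by exists ((F c - F a0) / (c - a0)), a0.
have S_sup : has_sup S.
  by split => //; exists ((F b0 - F c) / (b0 - c)); exact: slope_ub.
have supl a : D a -> a < c -> F c - F a <= sup S * (c - a).
  move=> Da ac; rewrite -ler_pdivrMr ?subr_gt0//.
  by apply: ub_le_sup; [exact: S_sup.2|exists a].
have supr b : D b -> c < b -> sup S * (b - c) <= F b - F c.
  move=> Db cb; rewrite -ler_pdivlMr ?subr_gt0//.
  by apply: ge_sup => //; exact: slope_ub.
exists (sup S); split => a b Da Db.
- rewrite le_eqVlt => /predU1P[-> _|ab]; first by rewrite !subrr mulr0.
  rewrite le_eqVlt => /predU1P[bc|bc]; first by rewrite bc in ab *; exact: supl.
  rewrite -(ler_pM2r (x := c - b)) ?subr_gt0//.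
  apply: (le_trans (convex_function_slope cF Da Dc ab bc)).
  by rewrite mulrAC ler_pM2r ?subr_gt0// supl.
- rewrite le_eqVlt => /predU1P[ca|ca].
    rewrite -ca le_eqVlt => /predU1P[->|cb]; first by rewrite !subrr mulr0.
    exact: supr.
  rewrite le_eqVlt => /predU1P[->|ab]; first by rewrite !subrr mulr0.
  rewrite -(ler_pM2r (x := a - c)) ?subr_gt0//.
  apply: (le_trans _ (convex_function_slope cF Dc Db ca ab)).
  by rewrite mulrAC ler_pM2r ?subr_gt0// supr.
Qed.
End slopes.

(** * Integrals of quadratic polynomials *)

Section quadratic_integral.
Variable R : realType.

Lemma integral_quadratic (a b p q s : R) : a <= b ->
  (\int[lebesgue_measure]_(x in `[a, b]) (p + q * x + s * x ^+ 2)%:E =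
   (p * (b - a) + q * (b ^+ 2 - a ^+ 2) / 2 + s * (b ^+ 3 - a ^+ 3) / 3)%:E)%E.
Proof.
rewrite le_eqVlt => /predU1P[<-|ab].
  by rewrite set_itv1 integral_set1 !subrr !mulr0 !mul0r !addr0.
pose F (x : R) := p * x + q * x ^+ 2 / 2 + s * x ^+ 3 / 3.
have dF (x : R) : is_derive x 1 F (p + q * x + s * x ^+ 2).
  apply: is_derive_eq.
  by rewrite /GRing.scale/=; field.
etransitivity.
  apply: (@continuous_FTC2 _ (fun x => p + q * x + s * x ^+ 2) F a b ab).
- apply: continuous_subspaceT => x.
  by apply: differentiable_continuous; apply/derivable1_diffP.
- have cF : continuous F.
    move=> x; apply: differentiable_continuous; apply/derivable1_diffP.
    exact: ex_derive.
  split => [x _||].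
  + exact: ex_derive.
  + exact/cvg_at_right_filter/cF.
  + exact/cvg_at_left_filter/cF.
- by move=> x _; rewrite derive1E derive_val.
by rewrite /F -EFinB; congr EFin; field.
Qed.
End quadratic_integral.

(** * Distribution functions with bounded slope *)

Section bounded_slope.
Variable R : realType.
Local Open Scope ereal_scope.
Let RR := measurableTypeR R.
Variable m : probability (measurableTypeR R) R.
Let F (x : R) : R := fine (m [set` `]-oo, x]]).
Local Notation leb := (@lebesgue_measure R).

Lemma probability_lebesgue_stieltjes : exists f : cumulative R R,
  (forall x, f x = F x) /\
  forall A, measurable A -> lebesgue_stieltjes_measure f A = m A.
Proof.
by eexists; split; last exact: lebesgue_stieltjes_cdf_id.
Qed.

Lemma fine_cdf_homo : {homo F : x y / (x <= y)%R}.
Proof.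
have [f [fE _]] := probability_lebesgue_stieltjes.
by move=> x y xy; rewrite -!fE; exact: cumulative_is_nondecreasing.
Qed.

Lemma probability_itvoc (x y : R) : (x <= y)%R ->
  m [set` `]x, y]] = (F y - F x)%:E.
Proof.
move=> xy; have [f [fE fm]] := probability_lebesgue_stieltjes.
rewrite -fm// /lebesgue_stieltjes_measure /measure_extension.
rewrite measurable_mu_extE/=; last exact: is_ocitv.
by rewrite wlength_itv_bnd// !fE.
Qed.

(** The right-hand side is [K] times the Lebesgue integral of the same even
    quadratic polynomial. *)
Lemma integral_le_slope (a b K p s : R) : (a <= b)%R -> (0 <= K)%R ->
  (forall x y : R, (a <= x)%R -> (x <= y)%R -> (y <= b)%R ->
     (F y - F x <= K * (y - x))%R) ->
  (forall x : R, (a < x)%R -> (x <= b)%R -> (0 <= p + s * x ^+ 2)%R) ->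
  \int[m]_(x in [set` `]a, b]]) (p + s * x ^+ 2)%:E <=
  (K * (p * (b - a) + s * (b ^+ 3 - a ^+ 3) / 3))%:E.
Proof.
move=> ab K0 FK g0.
have mg (D : set RR) : measurable_fun D (fun x : RR => (p + s * x ^+ 2)%R).
  apply: measurable_funTS; apply: measurable_funD => //.
  by apply: measurable_funM.
have Dg0 x : [set` `]a, b]] x -> (0 <= p + s * x ^+ 2)%R.
  by rewrite /= in_itv/= => /andP[]; exact: g0.
have -> : (K * (p * (b - a) + s * (b ^+ 3 - a ^+ 3) / 3))%:E =
    K%:E * \int[leb]_(x in [set` `]a, b]]) (p + s * x ^+ 2)%:E.
  rewrite integral_itv_obnd_cbnd; last by apply/measurable_EFinP; exact: mg.
  have := integral_quadratic p 0 s ab.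
  rewrite !mul0r addr0 EFinM => <-.
  by congr (_ * _); apply: eq_integral => x _; rewrite mul0r addr0.
rewrite -[leLHS]mul1e; apply: ge0_le_integral_lebesgue_stieltjes => //.
move=> x y xy; rewrite mul1e -EFinM.
set x' := Num.max x a; set y' := Num.min y b.
have xx' : (x <= x')%R by rewrite le_max lexx.
have ax' : (a <= x')%R by rewrite le_max lexx orbT.
have y'y : (y' <= y)%R by rewrite ge_min lexx.
have y'b : (y' <= b)%R by rewrite ge_min lexx orbT.
apply: (@le_trans _ _ (m [set` `]x', y']])).
  apply: le_measure; rewrite ?inE//=; first exact: measurableI.
  move=> z [] /=; rewrite !in_itv/= gt_max le_min.
  by move=> /andP[-> ->] /andP[-> ->].
have [y'x'|x'y'] := leP y' x'.
  rewrite set_itv_ge ?bnd_simp -?leNgt// measure0 lee_fin mulr_ge0//.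
  by rewrite subr_ge0 ltW.
rewrite (probability_itvoc (ltW x'y')) lee_fin.
apply: (le_trans (FK _ _ ax' (ltW x'y') y'b)).
by rewrite ler_wpM2l// lerB.
Qed.

(** The slope hypothesis leaves out the right endpoint [b], where the
    distribution may have an atom: an atom there only helps. *)
Lemma integral_ge_slope (t : bool) (a b K p s : R) : (a <= b)%R -> (0 <= K)%R ->
  (forall x y : R, (a <= x)%R -> (x <= y)%R -> (y < b)%R ->
     (K * (y - x) <= F y - F x)%R) ->
  (forall x : R, (a < x)%R -> (x <= b)%R -> (0 <= p + s * x ^+ 2)%R) ->
  (K * (p * (b - a) + s * (b ^+ 3 - a ^+ 3) / 3))%:E <=
  \int[m]_(x in [set` Interval (BRight a) (BSide t b)]) (p + s * x ^+ 2)%:E.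
Proof.
move=> ab K0 FK g0.
have [f [fE fm]] := probability_lebesgue_stieltjes.
set D : set RR := [set` _].
have mD : measurable D by exact: measurable_itv.
have mg (E : set RR) : measurable_fun E (fun x : RR => (p + s * x ^+ 2)%R).
  apply: measurable_funTS; apply: measurable_funD => //.
  by apply: measurable_funM.
have Dab x : D x -> [/\ (a < x)%R & (x <= b)%R].
  by rewrite /D /= in_itv/= => /andP[-> /lteifW ->].
have -> : (K * (p * (b - a) + s * (b ^+ 3 - a ^+ 3) / 3))%:E =
    K%:E * \int[leb]_(x in D) (p + s * x ^+ 2)%:E.
  have := integral_quadratic p 0 s ab.
  rewrite !mul0r addr0 EFinM => <-.
  congr (_ * _).
  under eq_integral do rewrite mul0r addr0.
  rewrite /D integral_itv_bndoo; last by apply/measurable_EFinP; exact: mg.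
  rewrite [RHS]integral_itv_bndoo; last by apply/measurable_EFinP; exact: mg.
  by [].
have -> : \int[m]_(x in D) (p + s * x ^+ 2)%:E =
    \int[lebesgue_stieltjes_measure f]_(x in D) (p + s * x ^+ 2)%:E.
  by apply: eq_measure_integral => A mA _; exact/esym/fm.
rewrite -[leRHS]mul1e.
apply: ge0_le_integral_lebesgue_stieltjes => //; last first.
  by move=> x /Dab[]; exact: g0.
move=> x y xy; rewrite mul1e !fE.
set x' := Num.max x a; set y' := Num.min y b.
have xx' : (x <= x')%R by rewrite le_max lexx.
have ax' : (a <= x')%R by rewrite le_max lexx orbT.
have y'y : (y' <= y)%R by rewrite ge_min lexx.
have y'b : (y' <= b)%R by rewrite ge_min lexx orbT.
have Fxy : (0 <= F y - F x)%R by rewrite subr_ge0 fine_cdf_homo// ltW.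
have : leb ([set` `]x, y]] `&` D) <= leb [set` `]x', y']].
  apply: le_measure; rewrite ?inE//=; first exact: measurableI.
  move=> z [/=]; rewrite !in_itv/= gt_max le_min => /andP[-> ->].
  by move=> /Dab[-> ->].
move=> /(lee_wpmul2l (x := K%:E)); rewrite lee_fin => /(_ K0).
move=> /le_trans; apply.
rewrite lebesgue_measure_itv/= lte_fin.
case: ifPn => [x'y'|_]; last by rewrite mule0 lee_fin.
rewrite -EFinB -EFinM lee_fin.
move: K0; rewrite le_eqVlt => /predU1P[<-|K0]; first by rewrite mul0r.
(* [F] may jump at [y'], so its slope is bounded only up to points before it *)
rewrite mulrC -ler_pdivlMr// lerBlDr; apply/unstable.ler_ltP => z zy'.
have [zx'|x'z] := leP z x'.
  by rewrite (le_trans zx')// lerDr divr_ge0// ltW.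
rewrite -lerBlDr ler_pdivlMr// mulrC.
apply: le_trans (FK _ _ ax' (ltW x'z) (lt_le_trans zy' y'b)) _.
by rewrite lerB// fine_cdf_homo// (le_trans (ltW zy')).
Qed.
End bounded_slope.

(** * Second moments of unimodal distributions on one side of the mode *)

Section comparison.
Local Open Scope ereal_scope.

(** [phi <= psi] may fail pointwise on [B]: the deficit [h2] there is paid for by
    the excess [h1] on [C].  The real number [w] between the two integrals makes
    it possible to subtract them. *)
Lemma ge0_integral_le_of_transfer d (T : measurableType d) (R : realType)
    (m : {measure set T -> \bar R}) (E B C : set T) (phi psi h1 h2 : T -> R)
    (w : R) :
  measurable E -> measurable B -> measurable C -> B `<=` E -> C `<=` E ->
  measurable_fun setT phi -> measurable_fun setT psi ->
  measurable_fun setT h1 -> measurable_fun setT h2 ->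
  (forall x, E x -> (0 <= phi x)%R) -> (forall x, E x -> (0 <= psi x)%R) ->
  (forall x, C x -> (0 <= h1 x)%R) -> (forall x, B x -> (0 <= h2 x)%R) ->
  (forall x, E x -> (phi x + (h1 \_ C) x <= psi x + (h2 \_ B) x)%R) ->
  \int[m]_(x in B) (h2 x)%:E <= w%:E -> w%:E <= \int[m]_(x in C) (h1 x)%:E ->
  \int[m]_(x in E) (phi x)%:E <= \int[m]_(x in E) (psi x)%:E.
Proof.
move=> mE mB mC BE CE mphi mpsi mh1 mh2 phi0 psi0 h10 h20 le_pt leB geC.
have restr (D : set T) (h : T -> R) : measurable D -> D `<=` E ->
    measurable_fun setT h -> (forall x, D x -> (0 <= h x)%R) ->
    [/\ measurable_fun E (h \_ D), (forall x, (0 <= (h \_ D) x)%R) &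
        \int[m]_(x in E) ((h \_ D) x)%:E = \int[m]_(x in D) (h x)%:E].
  move=> mD DE mh h0; split.
  - apply: measurable_funTS; apply/(measurable_restrictT _ mD).
    exact: measurable_funTS.
  - by move=> x; rewrite patchE; case: ifPn => // /set_mem/h0.
  - rewrite -[in RHS](setIidr DE) integral_mkcondr.
    by apply: eq_integral => x _; rewrite !patchE; case: ifPn.
have [mC1 C10 C1E] := restr _ _ mC CE mh1 h10.
have [mB2 B20 B2E] := restr _ _ mB BE mh2 h20.
have : \int[m]_(x in E) (phi x + (h1 \_ C) x)%:E <=
       \int[m]_(x in E) (psi x + (h2 \_ B) x)%:E.
  apply: ge0_le_integral => //.
  - by move=> x Ex; rewrite lee_fin addr_ge0// phi0.
  - apply/measurable_EFinP; apply: measurable_funD => //.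
    exact: measurable_funTS.
  - apply/measurable_EFinP; apply: measurable_funD => //.
    exact: measurable_funTS.
have intD (f g : T -> R) : measurable_fun E f -> measurable_fun E g ->
    (forall x, E x -> (0 <= f x)%R) -> (forall x, E x -> (0 <= g x)%R) ->
    \int[m]_(x in E) (f x + g x)%:E =
    \int[m]_(x in E) (f x)%:E + \int[m]_(x in E) (g x)%:E.
  move=> mf mg f0 g0; rewrite -ge0_integralD//; exact/measurable_EFinP.
rewrite !intD//; try exact: measurable_funTS.
rewrite C1E B2E => le_sum.
rewrite -(leeD2rE (x := w%:E))//.
by apply: (le_trans _ (le_trans le_sum _)); exact: leeD2l.
Qed.
End comparison.

Section unimodal_moment.
Variable R : realType.
Local Open Scope ereal_scope.
Let RR := measurableTypeR R.
Variable m : probability (measurableTypeR R) R.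
Let F (x : R) : R := fine (m [set` `]-oo, x]]).

Let mquad (p s : R) : measurable_fun setT (fun x : RR => (p + s * x ^+ 2)%R).
Proof. by apply: measurable_funD => //; apply: measurable_funM. Qed.

(** For a nondecreasing density [f] on [`]-oo, a[], the constant [a^2/4] is the
    second moment of the uniform law on the interval from [-a/2] to [a], the
    extremal case.  Accordingly [x^2 - a^2/4] has integral 0 over that interval;
    it is negative exactly on [`]-a/2, a/2[], where it is integrated against at
    most [f (a/2)], while it is integrated against at least [f (a/2)] on
    [`]a/2, a[]. *)
Lemma second_moment_below_mode (a : R) : (0 < a)%R ->
  @convex_function R R^o [set` `]-oo, a[] F ->
  (a ^+ 2 / 4)%:E * m [set` `]-oo, a[] <=
  \int[m]_(x in [set` `]-oo, a[]) (x ^+ 2)%:E.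
Proof.
move=> a0 cF.
have inD x : (x < a)%R -> [set` `]-oo, a[] x by rewrite /= in_itv.
have [| | | | |K [Kle Kge]] :=
  convex_function_subgradient
    (a0 := 0%R) (c := (a / 2)%R) (b0 := (3 * a / 4)%R) cF.
- by apply: inD; lra.
- by apply: inD; lra.
- by apply: inD; lra.
- by lra.
- by lra.
have K0 : (0 <= K)%R.
  have : (F 0 <= F (a / 2))%R by apply: fine_cdf_homo; lra.
  have := Kle 0%R (a / 2)%R (inD _ _) (inD _ _) _ (lexx _).
  by rewrite subr0; nra.
rewrite -integral_cst; last exact: measurable_itv.
apply: (@ge0_integral_le_of_transfer _ _ _ m _
  [set` `](- (a / 2))%R, (a / 2)%R]] [set` `](a / 2)%R, a[]
  (cst (a ^+ 2 / 4)) (fun x => x ^+ 2)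
  (fun x => - (a ^+ 2 / 4) + 1 * x ^+ 2)
  (fun x => a ^+ 2 / 4 + - 1 * x ^+ 2) (K * (a ^+ 3 / 6)))%R => //.
- by move=> x /=; rewrite !in_itv/=; lra.
- by move=> x /=; rewrite !in_itv/=; lra.
- by move=> x _ /=; rewrite divr_ge0// sqr_ge0.
- by move=> x _; rewrite sqr_ge0.
- by move=> x /=; rewrite in_itv/= => /andP[? ?]; nra.
- by move=> x /=; rewrite in_itv/= => /andP[? ?]; nra.
- move=> x; rewrite /= in_itv/= => xa.
  rewrite !patchE !mem_setE !in_itv/= -[point]/(0%R : R).
  have [ax|xa2] := ltP (a / 2)%R (x : R); rewrite ?xa ?andbT ?andbF /=.
    by nra.
  case: ifPn => [|]; rewrite -?leNgt => ?; nra.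
- have := @integral_le_slope R m (- (a / 2)) (a / 2) K (a ^+ 2 / 4) (- 1).
  have -> : (a ^+ 2 / 4 * (a / 2 - - (a / 2)) +
    -1 * ((a / 2) ^+ 3 - (- (a / 2)) ^+ 3) / 3 = a ^+ 3 / 6)%R by field.
  apply => //; first by lra.
    by move=> x y ax xy yb; apply: Kle => //; apply: inD; lra.
  by move=> x *; nra.
- have := @integral_ge_slope R m true (a / 2) a K (- (a ^+ 2 / 4)) 1.
  have -> : (- (a ^+ 2 / 4) * (a - a / 2) +
    1 * (a ^+ 3 - (a / 2) ^+ 3) / 3 = a ^+ 3 / 6)%R by field.
  apply => //; first by lra.
    by move=> x y ax xy yb; apply: Kge => //; apply: inD; lra.
  by move=> x *; nra.
Qed.

(** With a nonincreasing density [f] on [`]a, +oo[], the function [x^2 - a^2/4]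
    minus the step of height [(9 r^2 - 6 a^2)/4] at [r] is positive on
    [`]a, r[], negative on [`]r, y[] with [4 y^2 = 9 r^2 - 5 a^2], and positive
    beyond, so comparison with [f r] on both sides of [r] suffices.  The weight
    on the left outbalances the one on the right exactly when
    [8 y^3 <= 27 r^3 - 18 a^2 r - a^3]; after squaring, the difference of the
    two sides has the factor [9 a^2 (r - a)].  An atom at the mode [a] does no
    harm because [a^2/4 <= a^2]. *)
Lemma second_moment_above_mode (a r : R) : (0 <= a)%R -> (a < r)%R ->
  concave_function [set` `[a, +oo[] F ->
  (a ^+ 2 / 4)%:E * m [set` `[a, +oo[] +
    ((9 * r ^+ 2 - 6 * a ^+ 2) / 4)%:E * m [set` `[r, +oo[] <=
  \int[m]_(x in [set` `[a, +oo[]) (x ^+ 2)%:E.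
Proof.
move=> a0 ar cF.
have inD x : (a <= x)%R -> [set` `[a, +oo[] x by rewrite /= in_itv/= andbT.
have subgrad c : (a < c)%R -> exists K : R, (0 <= K)%R /\
    (forall x y, (a <= x)%R -> (x <= y)%R -> (y <= c)%R ->
      (K * (y - x) <= F y - F x)%R) /\
    (forall x y, (c <= x)%R -> (x <= y)%R -> (F y - F x <= K * (y - x))%R).
  move=> ac.
  have [| | | | |K [Kle Kge]] :=
    convex_function_subgradient (a0 := a) (c := c) (b0 := (c + 1)%R) cF.
  - by apply: inD; lra.
  - by apply: inD; lra.
  - by apply: inD; lra.
  - by lra.
  - by lra.
  exists (- K)%R; split; [|split].
  - have : (F c <= F (c + 1))%R by apply: fine_cdf_homo; lra.
    by have := Kge c (c + 1)%R (inD _ _) (inD _ _) (lexx _) _; lra.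
  - by move=> x y ax xy yc; have := Kle x y (inD _ _) (inD _ _) xy yc; lra.
  - by move=> x y cx xy; have := Kge x y (inD _ _) (inD _ _) cx xy; lra.
(* a finite slope on the left of [r] excludes an atom at [r] *)
have mr0 : m [set r] = 0.
  have [L [L0 [_ Lge]]] := subgrad ((a + r) / 2)%R ltac:(lra).
  apply/eqP; rewrite eq_le measure_ge0 andbT.
  apply/lee_addgt0Pr => e e0; rewrite add0e.
  have L1 : (0 < L + 1)%R by lra.
  have d0 : (0 < e / (L + 1))%R by rewrite divr_gt0.
  pose x : R := Num.max ((a + r) / 2)%R (r - e / (L + 1))%R.
  have xr : (x < r)%R by rewrite gt_max; lra.
  have cx : ((a + r) / 2 <= x)%R by rewrite le_max lexx.
  have dx : (r - e / (L + 1) <= x)%R by rewrite le_max lexx orbT.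
  apply: (@le_trans _ _ (m [set` `]x, r]])).
    apply: le_measure; rewrite ?inE//=.
    by move=> z /= ->; rewrite in_itv/= xr lexx.
  rewrite (probability_itvoc _ (ltW xr)) lee_fin.
  apply: (le_trans (Lge _ _ cx (ltW xr))).
  apply: (@le_trans _ _ (L * (e / (L + 1)))%R).
    by rewrite ler_wpM2l//; lra.
  by rewrite mulrA ler_pdivrMr//; nra.
have mr : m [set` `[r, +oo[] <= m [set` `]r, +oo[].
  apply: (@le_trans _ _ (m ([set r] `|` [set` `]r, +oo[]))).
    apply: le_measure; rewrite ?inE//=; first exact: measurableU.
    move=> z /=; rewrite !in_itv/= !andbT le_eqVlt.
    by move=> /predU1P[->|]; [left|right].
  apply: (le_trans (measureU2 _ _ _)) => //.
  by rewrite -[leRHS]add0e -mr0.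
have [K [K0 [Kle Kge]]] := subgrad r ar.
pose c : R := ((9 * r ^+ 2 - 6 * a ^+ 2) / 4)%R.
have c0 : (0 <= c)%R by rewrite /c; nra.
apply: (@le_trans _ _ ((a ^+ 2 / 4)%:E * m [set` `[a, +oo[] +
    c%:E * m [set` `]r, +oo[])).
  by apply: leeD2l; apply: lee_wpmul2l; rewrite ?lee_fin.
pose phi (x : RR) : R := (a ^+ 2 / 4 + c * \1_[set` `]r, +oo[] x)%R.
have mphi : measurable_fun setT phi.
  by apply: measurable_funD => //; apply: measurable_funM.
have -> : (a ^+ 2 / 4)%:E * m [set` `[a, +oo[] + c%:E * m [set` `]r, +oo[] =
    \int[m]_(x in [set` `[a, +oo[]) (phi x)%:E.
  rewrite /phi; under eq_integral do rewrite EFinD.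
  have mind : measurable_fun [set` `[a, +oo[]
      (fun x : RR => (c * \1_[set` `]r, +oo[] x)%:E).
    by apply/measurable_EFinP; apply: measurable_funM.
  rewrite ge0_integralD//; first last.
  - by move=> x _; rewrite lee_fin mulr_ge0// indicE.
  - by move=> x _; rewrite lee_fin divr_ge0// sqr_ge0.
  congr (_ + _); first by rewrite integral_cst.
  under eq_integral do rewrite EFinM.
  rewrite ge0_integralZl//; last by apply/measurable_EFinP.
  rewrite integral_indic// setIidl// => x /=.
  by rewrite !in_itv/= !andbT; lra.
pose y := Num.sqrt ((9 * r ^+ 2 - 5 * a ^+ 2) / 4)%R.
have y2 : (y ^+ 2 = (9 * r ^+ 2 - 5 * a ^+ 2) / 4)%R.
  by rewrite sqr_sqrtr//; nra.
have y0 : (0 <= y)%R by exact: sqrtr_ge0.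
have ry : (r <= y)%R by rewrite -(@ler_pXn2r _ 2)// ?nnegrE// ?y2; nra.
have cy : (a ^+ 2 / 4 + c = y ^+ 2)%R by rewrite y2 /c; field.
have cubic : (8 * y ^+ 3 <= 27 * r ^+ 3 - 18 * a ^+ 2 * r - a ^+ 3)%R.
  have cube0 : (0 <= 27 * r ^+ 3 - 18 * a ^+ 2 * r - a ^+ 3)%R.
    have -> : (27 * r ^+ 3 - 18 * a ^+ 2 * r - a ^+ 3 = (r - a) *
      (26 * r ^+ 2 + 26 * r * a + 8 * a ^+ 2) + (r ^+ 3 + 7 * a ^+ 3))%R by ring.
    have r0 : (0 <= r)%R by lra.
    have ra0 : (0 <= r - a)%R by lra.
    have q1 : (0 <= 26 * r ^+ 2 + 26 * r * a + 8 * a ^+ 2)%R by nra.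
    have q2 : (0 <= r ^+ 3 + 7 * a ^+ 3)%R.
      by rewrite addr_ge0 ?mulr_ge0 ?exprn_ge0.
    by rewrite addr_ge0// mulr_ge0.
  rewrite -(@ler_pXn2r _ 2)// ?nnegrE ?mulr_ge0 ?exprn_ge0//.
  have -> : ((8 * y ^+ 3) ^+ 2 = (9 * r ^+ 2 - 5 * a ^+ 2) ^+ 3)%R.
    have -> : ((8 * y ^+ 3) ^+ 2 = (4 * y ^+ 2) ^+ 3)%R by ring.
    by rewrite y2; congr (_ ^+ 3)%R; field.
  rewrite -subr_ge0.
  have -> : ((27 * r ^+ 3 - 18 * a ^+ 2 * r - a ^+ 3) ^+ 2 -
      (9 * r ^+ 2 - 5 * a ^+ 2) ^+ 3 = 9 * a ^+ 2 * (r - a) *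
      ((r - a) * (27 * r ^+ 2 + 48 * r * a + 30 * a ^+ 2) + 16 * a ^+ 3))%R.
    by ring.
  have r0 : (0 <= r)%R by lra.
  have ra0 : (0 <= r - a)%R by lra.
  have q1 : (0 <= 27 * r ^+ 2 + 48 * r * a + 30 * a ^+ 2)%R by nra.
  by rewrite !mulr_ge0 ?sqr_ge0// addr_ge0// ?mulr_ge0 ?exprn_ge0.
pose w : R := (K * (2 / 3 * y ^+ 3 - y ^+ 2 * r + r ^+ 3 / 3))%R.
apply: (@ge0_integral_le_of_transfer _ _ _ m _
  [set` `]r, y]] [set` `]a, r]] phi (fun x => x ^+ 2)
  (fun x => - (a ^+ 2 / 4) + 1 * x ^+ 2)
  (fun x => y ^+ 2 + - 1 * x ^+ 2) w)%R => //.
- by move=> x /=; rewrite !in_itv/= andbT; lra.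
- by move=> x /=; rewrite !in_itv/= andbT; lra.
- by move=> x _; rewrite /phi indicE addr_ge0 ?divr_ge0 ?sqr_ge0// mulr_ge0.
- by move=> x _; rewrite sqr_ge0.
- by move=> x /=; rewrite in_itv/= => /andP[? ?]; nra.
- by move=> x /=; rewrite in_itv/= => /andP[? ?]; nra.
- move=> x; rewrite /= in_itv/= andbT => ax.
  rewrite /phi indicE !patchE !mem_setE !in_itv/= -[point]/(0%R : R) andbT.
  have [rx|xr] := ltP r (x : R); rewrite ?(ltW rx) ?andbT ?andbF /=.
    rewrite mulr1 cy.
    by case: ifPn; rewrite -?ltNge => ?; nra.
  by rewrite mulr0; case: ifPn; rewrite -?leNgt => ?; nra.
- have := @integral_le_slope R m r y K (y ^+ 2) (- 1).
  have -> : (K * (y ^+ 2 * (y - r) + -1 * (y ^+ 3 - r ^+ 3) / 3) = w)%R.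
    by rewrite /w; field.
  apply => //; first by move=> ? ? ? ? _; exact: Kge.
  by move=> x *; nra.
- apply: le_trans; last first.
    apply: (@integral_ge_slope R m false a r K (- (a ^+ 2 / 4)) 1) => //.
    + exact: ltW.
    + by move=> ? ? ? ? ?; apply: Kle => //; exact: ltW.
    + by move=> x *; nra.
  by rewrite lee_fin /w ler_wpM2l//; nra.
Qed.
End unimodal_moment.

(** * Standardization and shifted second moments *)

Section moments.
Local Open Scope ereal_scope.
Context d (T : measurableType d) (R : realType) (P : probability T R).
Variable Z : {RV P >-> R}.

Lemma integral_sqrD (k : R) : \int[P]_t (Z t ^+ 2)%:E < +oo ->
  \int[P]_t ((Z t + k) ^+ 2)%:E =
  \int[P]_t (Z t ^+ 2)%:E + (2 * k)%:E * \int[P]_t (Z t)%:E + (k ^+ 2)%:E.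
Proof.
move=> Z2fin.
have mZ : measurable_fun setT Z by [].
have mZ2 : measurable_fun setT (fun t => Z t ^+ 2)%R by exact: measurable_funX.
have iZ2 : P.-integrable setT (fun t => (Z t ^+ 2)%:E).
  apply/integrableP; split; first exact/measurable_EFinP.
  by under eq_integral do rewrite gee0_abs ?lee_fin ?sqr_ge0//.
have icst (r : R) : P.-integrable setT (cst r%:E).
  by apply: finite_measure_integrable_cst.
have iZ : P.-integrable setT (fun t => (Z t)%:E).
  apply: (le_integrable _ _ _ (integrableD _ (icst 1%R) iZ2)) => //.
    exact/measurable_EFinP.
  move=> t _; rewrite /= lee_fin.
  have : (0 <= 1 + Z t ^+ 2)%R by rewrite addr_ge0 ?sqr_ge0.
  move/ger0_norm => ->.
  by rewrite ler_norml; nra.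
have iZk : P.-integrable setT (fun t => (2 * k)%:E * (Z t)%:E).
  exact: integrableZl.
transitivity (\int[P]_t ((Z t ^+ 2)%:E + (2 * k)%:E * (Z t)%:E + (k ^+ 2)%:E)).
  by apply: eq_integral => t _; rewrite -EFinM -!EFinD; congr EFin; ring.
rewrite (integralD _ (integrableD _ iZ2 iZk) (icst _))//.
rewrite (integralD _ iZ2 iZk)// integralZl//; congr (_ + _).
by rewrite integral_cst// -[RHS]mule1; congr (_ * _); exact: probability_setT.
Qed.

Lemma standardized_second_moment : standardized Z ->
  \int[P]_t (Z t)%:E = 0 /\ \int[P]_t (Z t ^+ 2)%:E = 1.
Proof.
move=> [EZ VZ]; split; first by rewrite -expectation_def.
move: VZ; rewrite /variance unlock EZ expectation.unlock => <-.
by apply: eq_integral => t _; rewrite !fctE/= subr0 expr2.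
Qed.

(** The mean is recovered from the values at [k = 0] and [k = 1]; only integrals
    of nonnegative functions have to be computed. *)
Lemma standardized_of_second_moments :
  (forall k : R, \int[P]_t ((Z t + k) ^+ 2)%:E = (1 + k ^+ 2)%:E) ->
  standardized Z.
Proof.
move=> Zk.
have Z2 : \int[P]_t (Z t ^+ 2)%:E = 1.
  have := Zk 0%R; rewrite expr0n/= addr0 => <-.
  by apply: eq_integral => t _; rewrite addr0.
have := integral_sqrD 1; rewrite Z2 ltry => /(_ isT).
rewrite Zk mulr1 expr1n => EZ.
have EZ0 : \int[P]_t (Z t)%:E = 0.
  move: EZ; case: (\int[P]_t (Z t)%:E) => [e| |].
  - rewrite -EFinM -!EFinD => -[] h; congr EFin; lra.
  - by rewrite mulry gtr0_sg// mul1e.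
  - by rewrite mulrNy gtr0_sg// mul1e.
split; first by rewrite expectation_def.
rewrite /variance unlock expectation_def EZ0 /= -Z2 expectation.unlock.
by apply: eq_integral => t _; rewrite !fctE/= subr0 expr2.
Qed.
End moments.

(** * The one-sided Vysochanskii-Petunin inequality *)

Section vysochanskii_petunin.
Variable R : realType.
Local Open Scope ereal_scope.
Let RR := measurableTypeR R.

Lemma convex_functionW (D E : set R) (F : R -> R) : D `<=` E ->
  @convex_function R R^o E F -> @convex_function R R^o D F.
Proof.
move=> DE /convex_functionE cF.
apply/convex_functionE => t x y t0 t1 /DE ? /DE ?.
exact: cF.
Qed.

(** The witness is the mode clamped to [0, r].  The density is nondecreasing
    below [b] when [b > 0], and nonincreasing above [b] when [b < r].  If
    [b = 0], the estimate below [b] is trivial; if [b = r], the estimate above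
    [b] is [r^2 <= x^2]. *)
Lemma one_sided_vysochanskii_petunin (m : probability (measurableTypeR R) R)
    (M r : R) : (0 < r)%R ->
  unimodal_at (fun x => fine (m [set` `]-oo, x]])) M ->
  exists b : R, [/\ (0 <= b)%R, (b <= r)%R &
    (b ^+ 2 / 4)%:E + ((9 * r ^+ 2 - 6 * b ^+ 2) / 4)%:E * m [set` `[r, +oo[]
      <= \int[m]_x (x ^+ 2)%:E].
Proof.
move=> r0 [cvF ccF].
suff [b [b0 br below above]] : exists b : R, [/\ (0 <= b)%R, (b <= r)%R,
    (b ^+ 2 / 4)%:E * m [set` `]-oo, b[] <=
      \int[m]_(x in [set` `]-oo, b[]) (x ^+ 2)%:E &
    (b ^+ 2 / 4)%:E * m [set` `[b, +oo[] +
      ((9 * r ^+ 2 - 6 * b ^+ 2) / 4)%:E * m [set` `[r, +oo[] <=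
      \int[m]_(x in [set` `[b, +oo[]) (x ^+ 2)%:E].
  exists b; split => //.
  have split_b : [set: RR] = [set` `]-oo, b[] `|` [set` `[b, +oo[].
    apply/seteqP; split => // x _ /=; rewrite !in_itv/= andbT.
    by case: (ltP (x : R) b); [left|right].
  have disj : [disjoint [set` `]-oo, b[] & [set` `[b, +oo[]].
    apply/disj_setPS => x [] /=; rewrite !in_itv/= andbT => xb.
    by rewrite leNgt xb.
  have m1 : m [set` `]-oo, b[] + m [set` `[b, +oo[] = 1.
    rewrite -measureU//; last exact/disj_set2P.
    by rewrite -split_b; exact: probability_setT.
  have b20 : 0 <= (b ^+ 2 / 4)%:E by rewrite lee_fin divr_ge0 ?sqr_ge0.
  rewrite split_b ge0_integral_setU//; last first.
  - by move=> x _; rewrite lee_fin sqr_ge0.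
  - by apply/measurable_EFinP; apply: measurable_funTS.
  apply: le_trans (leeD below above).
  by rewrite addeA -ge0_muleDr// m1 mule1.
have intge0 (D : set RR) : 0 <= \int[m]_(x in D) (x ^+ 2)%:E.
  by apply: integral_ge0 => x _; rewrite lee_fin sqr_ge0.
have [M0|M0] := leP M 0%R.
  exists 0%R; split => //; first exact: ltW.
    by rewrite expr0n/= mul0r mul0e.
  apply: second_moment_above_mode => //.
  apply: convex_functionW ccF => x /=; rewrite !in_itv/= !andbT.
  exact: le_trans.
have [rM|Mr] := leP r M.
  exists r; split => //; first exact: ltW.
    apply: second_moment_below_mode => //.
    apply: convex_functionW cvF => x /=; rewrite !in_itv/=.
    by move=> /lt_le_trans; exact.
  rewrite -ge0_muleDl ?lee_fin//; last 2 first.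
  - by nra.
  - by nra.
  rewrite -EFinD (_ : r ^+ 2 / 4 + (9 * r ^+ 2 - 6 * r ^+ 2) / 4 = r ^+ 2)%R;
    last by field.
  rewrite -integral_cst//; apply: ge0_le_integral => //.
  - by move=> x _; rewrite lee_fin sqr_ge0.
  - by apply/measurable_EFinP; apply: measurable_funTS.
  - move=> x /=; rewrite in_itv/= andbT => rx; rewrite lee_fin.
    by rewrite ler_pXn2r// nnegrE ltW// (lt_le_trans r0).
exists M; split; [exact: ltW|exact: ltW|exact: second_moment_below_mode|].
by apply: second_moment_above_mode => //; exact: ltW.
Qed.
End vysochanskii_petunin.

(** * The upper bound *)

Section shift.
Context d (T : measurableType d) (R : realType) (P : probability T R).
Variables (Z : {RV P >-> R}) (c : R).

(** The codomain carries the sigma-algebra generated by half-open intervals, the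
    one on which Lebesgue-Stieltjes measures live. *)
Definition shifted : T -> measurableTypeR R := fun t => Z t + c.

Let measurable_shifted : measurable_fun setT shifted.
Proof.
have : measurable_fun setT (fun t => Z t + c) by exact: measurable_funD.
exact.
Qed.

HB.instance Definition _ :=
  @isMeasurableFun.Build _ _ T (measurableTypeR R) shifted measurable_shifted.

Lemma shifted_cdf (x : R) :
  distribution P shifted [set` `]-oo, x]] = cdf Z (x - c).
Proof.
congr (P _); apply/seteqP; split=> t /=; rewrite !in_itv/= /shifted.
  by rewrite lerBrDr.
by rewrite lerBrDr.
Qed.

Lemma unimodal_at_shift (F : R -> R) (M : R) :
  unimodal_at F M -> unimodal_at (fun x => F (x - c)) (M + c).
Proof.
move=> [/convex_functionE cvF /convex_functionE ccF].
have affine (t x y : R) :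
    t * x + (1 - t) * y - c = t * (x - c) + (1 - t) * (y - c) by ring.
split; apply/convex_functionE => t x y t0 t1 /=; rewrite !in_itv/= => xM yM.
  by rewrite affine; apply: cvF => //=; rewrite in_itv/= ltrBlDr.
rewrite affine; apply: ccF => //=; rewrite in_itv/= lerBrDr.
- by move: xM; rewrite andbT.
- by move: yM; rewrite andbT.
Qed.
End shift.

(** Put [n = 1 + v^2] and [th = (b / (v + 1/v))^2], so that the hypothesis reads
    [th n + (9 - 6 th) n p <= 4], with [th] between 0 and 1.  The resulting bound
    for [n p] is monotone in [th], nondecreasing if [n <= 8/3] and nonincreasing
    if [n >= 8/3]; the two branches are its values at [th = 1] and [th = 0], and
    they meet at [n = 8/3], that is [v^2 = 5/3]. *)
Lemma solve_tail_bound (R : realFieldType) (v b p : R) :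
  0 < v -> 0 <= b -> b <= v + v^-1 ->
  b ^+ 2 / 4 + (9 * (v + v^-1) ^+ 2 - 6 * b ^+ 2) / 4 * p <= 1 + v^-1 ^+ 2 ->
  (v ^+ 2 <= 5 / 3 -> p <= (3 - v ^+ 2) / (3 * (1 + v ^+ 2))) /\
  (5 / 3 <= v ^+ 2 -> p <= 4 / 9 * (1 / (1 + v ^+ 2))).
Proof.
move=> v0 b0 br.
have r0 : 0 < v + v^-1 by rewrite addr_gt0// invr_gt0.
pose n := 1 + v ^+ 2.
have n0 : 0 < n by rewrite /n; nra.
pose th := (b / (v + v^-1)) ^+ 2.
have th0 : 0 <= th by exact: sqr_ge0.
have th1 : th <= 1.
  by rewrite expr_le1// ?divr_ge0// ?(ltW r0)// ler_pdivrMr// mul1r.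
have bE : b ^+ 2 = th * (v + v^-1) ^+ 2.
  by rewrite /th expr_div_n divfK// expf_neq0// gt_eqF.
have rE : (v + v^-1) ^+ 2 = n ^+ 2 / v ^+ 2.
  by rewrite /n; field; rewrite gt_eqF.
have -> : 1 + v^-1 ^+ 2 = n / v ^+ 2 by rewrite /n; field; rewrite gt_eqF.
have -> : b ^+ 2 / 4 + (9 * (v + v^-1) ^+ 2 - 6 * b ^+ 2) / 4 * p =
    n / v ^+ 2 * ((th * n + (9 - 6 * th) * (n * p)) / 4).
  by rewrite bE rE; field; rewrite gt_eqF.
rewrite ger_pMr ?divr_gt0 ?exprn_gt0// ler_pdivrMr// mul1r => bound.
have c0 : 0 < 9 - 6 * th by lra.
split=> hv.
  rewrite ler_pdivlMr ?mulr_gt0//.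
  suff : 3 * (n * p) <= 4 - n by rewrite /n; lra.
  have n83 : n <= 8 / 3 by rewrite /n; lra.
  rewrite -(ler_pM2l c0).
  have : 0 <= (1 - th) * (8 - 3 * n) by rewrite mulr_ge0//; lra.
  by nra.
rewrite ler_pdivlMr//.
suff : 9 * (n * p) <= 4 by rewrite /n; lra.
have n83 : 8 / 3 <= n by rewrite /n; lra.
rewrite -(ler_pM2l c0).
have : 0 <= th * (3 * n - 8) by rewrite mulr_ge0//; lra.
by nra.
Qed.

Section unimodal_tail_bound.
Local Open Scope ereal_scope.
Context d (T : measurableType d) (R : realType) (P : probability T R).
Variable Z : {RV P >-> R}.

Lemma unimodal_tail (v : R) : (0 < v)%R -> standardized Z -> unimodal Z ->
  exists b : R, [/\ (0 <= b)%R, (b <= v + v^-1)%R &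
    (b ^+ 2 / 4)%:E + ((9 * (v + v^-1) ^+ 2 - 6 * b ^+ 2) / 4)%:E *
      P [set t | (v <= Z t)%R] <= (1 + v^-1 ^+ 2)%:E].
Proof.
move=> v0 /standardized_second_moment[EZ EZ2] [M uM].
have c0 : (0 < v^-1)%R by rewrite invr_gt0.
have := @one_sided_vysochanskii_petunin _ (distribution P (shifted Z v^-1%R))
  (M + v^-1)%R (v + v^-1)%R (addr_gt0 v0 c0).
have -> : (fun x => fine (distribution P (shifted Z v^-1%R) [set` `]-oo, x]])) =
    (fun x => fine (cdf Z (x - v^-1))).
  by apply/funext => x; rewrite shifted_cdf.
move=> /(_ (unimodal_at_shift _ uM)) [b [b0 br]].
rewrite ge0_integral_distribution//; last 2 first.
- apply/measurable_EFinP => //.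
- by move=> x; rewrite lee_fin sqr_ge0.
have -> : \int[P]_x
    ((fun y : measurableTypeR R => (y ^+ 2)%:E) \o shifted Z v^-1%R) x =
    (1 + v^-1 ^+ 2)%:E.
  transitivity (\int[P]_t ((Z t + v^-1) ^+ 2)%:E) => //.
  by rewrite integral_sqrD EZ2 ?ltry// EZ mule0 adde0.
move=> bound; exists b; split => //.
have <- : distribution P (shifted Z v^-1%R) [set` `[(v + v^-1)%R, +oo[] =
    P [set t | (v <= Z t)%R].
  congr (P _); apply/seteqP; split=> t /=; rewrite in_itv/= andbT /shifted.
    by rewrite lerD2r.
  by rewrite lerD2r.
exact: bound.
Qed.

Lemma unimodal_tail_le (v : R) : (0 <= v)%R -> standardized Z -> unimodal Z ->
  ((v ^+ 2 <= 5 / 3)%R ->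
     P [set t | (v <= Z t)%R] <= ((3 - v ^+ 2) / (3 * (1 + v ^+ 2)))%:E) /\
  ((5 / 3 <= v ^+ 2)%R ->
     P [set t | (v <= Z t)%R] <= (4 / 9 * (1 / (1 + v ^+ 2)))%:E).
Proof.
have mA w : measurable [set t | (w <= Z t)%R].
  rewrite [X in measurable X](_ : _ = Z @^-1` [set` `[w, +oo[]).
    exact: measurable_funPTI.
  by apply/seteqP; split => t /=; rewrite in_itv/= andbT.
rewrite le_eqVlt => /predU1P[<- _ _|v0 sZ uZ].
  rewrite expr0n/=; split; last by move=> h; exfalso; lra.
  by move=> _; rewrite subr0 addr0 mulr1 divff// probability_le1.
have [b [b0 br]] := unimodal_tail v0 sZ uZ.
have /fineK <- : P [set t | (v <= Z t)%R] \is a fin_num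
  by exact: fin_num_measure.
have : (0 <= fine (P [set t | (v <= Z t)%R]))%R by rewrite fine_ge0.
move: (fine _) => p p0; rewrite -EFinM -EFinD !lee_fin.
exact: solve_tail_bound.
Qed.
End unimodal_tail_bound.

(** * The extremal distributions *)

Section uniform_probability.
Local Open Scope ereal_scope.
Variables (R : realType) (a b : R) (ab : (a < b)%R).
Let RR := measurableTypeR R.
Let ba0 : (0 < b - a)%R. Proof. by rewrite subr_gt0. Qed.

Lemma uniform_prob_itv (i : interval R) (x y : R) : (x <= y)%R ->
  [set` i] `&` [set` `[a, b]] = [set` `[x, y]] ->
  uniform_prob ab [set` i] = ((y - x) / (b - a))%:E.
Proof.
move=> xy ixy; rewrite /uniform_prob integral_uniform_pdf ixy.
rewrite (eq_integral (cst (b - a)^-1%:E)); last first.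
  move=> z; rewrite inE -ixy => -[_]; rewrite /= in_itv/= /uniform_pdf => ->.
  by [].
rewrite integral_cst//= lebesgue_measure_itv/= lte_fin.
case: ifPn => [_|]; first by rewrite -EFinB -EFinM mulrC.
rewrite -leNgt => yx; have -> : y = x by apply/eqP; rewrite eq_le yx.
by rewrite mule0 subrr mul0r.
Qed.

Lemma uniform_prob_Nyc (x : R) : uniform_prob ab [set` `]-oo, x]] =
  (Num.max 0 (Num.min 1 ((x - a) / (b - a))))%:E.
Proof.
have [xa|ax] := ltP x a.
  rewrite /uniform_prob integral_uniform_pdf.
  have -> : [set` `]-oo, x]] `&` [set` `[a, b]] = set0 :> set RR.
    by apply/seteqP; split => // z []; rewrite /= !in_itv/=; lra.
  rewrite integral_set0; congr EFin; apply/esym/max_idPl.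
  by rewrite ge_min pmulr_lle0 ?invr_gt0// subr_le0 (ltW xa) orbT.
have xa0 : (0 <= x - a)%R by rewrite subr_ge0.
have [xb|bx] := leP x b.
  rewrite (uniform_prob_itv (x := a) (y := x))//; last first.
    by apply/seteqP; split => [z []|z]; rewrite /= !in_itv/=; [lra|split; lra].
  rewrite min_r ?max_r// ?divr_ge0 ?(ltW ba0)//.
  by rewrite ler_pdivrMr// mul1r lerB.
rewrite (uniform_prob_itv (x := a) (y := b)) ?(ltW ab)//; last first.
  by apply/seteqP; split => [z []|z]; rewrite /= !in_itv/=; [lra|split; lra].
rewrite divff ?gt_eqF// min_l ?max_r//.
by rewrite ler_pdivlMr// mul1r lerB// ltW.
Qed.

Lemma uniform_prob_cy (x : R) : (a <= x)%R -> (x <= b)%R ->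
  uniform_prob ab [set` `[x, +oo[] = ((b - x) / (b - a))%:E.
Proof.
move=> ax xb; apply: uniform_prob_itv => //.
apply/seteqP; split => [z []|z]; rewrite /= !in_itv/= ?andbT; first by lra.
by split; lra.
Qed.

Lemma integral_uniform_sqr (k : R) :
  \int[uniform_prob ab]_x ((x + k) ^+ 2)%:E =
  (((b + k) ^+ 3 - (a + k) ^+ 3) / (3 * (b - a)))%:E.
Proof.
rewrite integral_uniform; last 2 first.
- by apply/measurable_EFinP; apply: measurable_funX; exact: measurable_funD.
- by move=> x; rewrite lee_fin sqr_ge0.
have -> : \int[lebesgue_measure]_(x in `[a, b]) ((x + k) ^+ 2)%:E =
   \int[lebesgue_measure]_(x in `[a, b]) (k ^+ 2 + 2 * k * x + 1 * x ^+ 2)%:E.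
  by apply: eq_integral => x _; congr EFin; ring.
rewrite integral_quadratic ?(ltW ab)// -EFinM; congr EFin.
by field; rewrite gt_eqF.
Qed.
End uniform_probability.

Lemma ltr_conv (R : realFieldType) (t x y b : R) :
  0 <= t -> t <= 1 -> x < b -> y < b -> t * x + (1 - t) * y < b.
Proof.
move=> t0 t1 xb yb; have [xy|yx] := leP x y.
  by apply: le_lt_trans yb; nra.
by apply: le_lt_trans xb; nra.
Qed.

Section atom_uniform.
Local Open Scope ereal_scope.
Context d (T : measurableType d) (R : realType) (P : probability T R).
Variables (Z : {RV P >-> R}) (p c q a b : R).
Hypotheses (p0 : (0 <= p)%R) (q0 : (0 <= q)%R) (pq1 : (p + q = 1)%R).
Hypothesis apuZ : atom_plus_uniform Z p c q a b.
Let RR := measurableTypeR R.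

Lemma atom_plus_uniform_sqr (k : R) : \int[P]_t ((Z t + k) ^+ 2)%:E =
  (p * (c + k) ^+ 2 +
   q * (((b + k) ^+ 3 - (a + k) ^+ 3) / (3 * (b - a))))%:E.
Proof.
have [ab distE] := apuZ.
pose m1 := mscale (NngNum p0) (@dirac _ RR c R).
pose m2 := mscale (NngNum q0) (uniform_prob ab).
have mk (D : set RR) : measurable_fun D (fun x : RR => ((x + k) ^+ 2)%:E).
  apply/measurable_EFinP/measurable_funTS.
  by apply: measurable_funX; exact: measurable_funD.
have k0 (x : RR) : 0 <= ((x + k) ^+ 2)%:E by rewrite lee_fin sqr_ge0.
transitivity (\int[distribution P (shifted Z 0)]_(x in [set: RR])
    ((x + k) ^+ 2)%:E).
  rewrite ge0_integral_distribution//.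
  by apply: eq_integral => t _; rewrite /= /shifted addr0.
transitivity (\int[measure_add m1 m2]_(x in [set: RR]) ((x + k) ^+ 2)%:E).
  apply: eq_measure_integral => A mA _.
  transitivity (m1 A + m2 A); last exact/esym/measure_addE.
  transitivity (distribution P Z A); last exact: distE.
  by congr (P _); apply/seteqP; split=> t /=; rewrite /shifted addr0.
rewrite ge0_integral_measure_add// !ge0_integral_mscale//.
rewrite integral_dirac// integral_uniform_sqr.
by rewrite diracT mul1e EFinD !EFinM.
Qed.

Lemma atom_plus_uniform_standardized :
  (p * c + q * ((a + b) / 2) = 0)%R ->
  (p * c ^+ 2 + q * ((a ^+ 2 + a * b + b ^+ 2) / 3) = 1)%R ->
  standardized Z.
Proof.
move=> mean0 moment2; apply: standardized_of_second_moments => k.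
have [ab _] := apuZ; rewrite atom_plus_uniform_sqr; congr EFin.
have -> : (((b + k) ^+ 3 - (a + k) ^+ 3) / (3 * (b - a)) =
    (a ^+ 2 + a * b + b ^+ 2) / 3 + 2 * k * ((a + b) / 2) + k ^+ 2)%R.
  by field; rewrite gt_eqF// subr_gt0.
transitivity ((p * c ^+ 2 + q * ((a ^+ 2 + a * b + b ^+ 2) / 3)) +
  2 * k * (p * c + q * ((a + b) / 2)) + (p + q) * k ^+ 2)%R; first by ring.
by rewrite mean0 moment2 pq1; ring.
Qed.

Lemma atom_plus_uniform_tail (v : R) : (a <= v)%R -> (v <= b)%R ->
  P [set t | (v <= Z t)%R] =
  (p * (v <= c)%R%:R + q * ((b - v) / (b - a)))%:E.
Proof.
move=> av vb; have [ab distE] := apuZ.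
transitivity (distribution P Z [set` `[v, +oo[]).
  by congr (P _); apply/seteqP; split=> t /=; rewrite in_itv/= andbT.
rewrite distE// uniform_prob_cy// diracE mem_setE in_itv/= andbT.
by rewrite EFinD !EFinM.
Qed.

Lemma atom_plus_uniform_cdf (x : R) : fine (cdf Z x) =
  (p * (c <= x)%R%:R + q * Num.max 0 (Num.min 1 ((x - a) / (b - a))))%R.
Proof.
have [ab distE] := apuZ.
by rewrite /cdf distE// uniform_prob_Nyc diracE mem_setE in_itv/=.
Qed.

(** Below [b] the distribution function is the convex ramp [q max(0, l)], with
    [l] affine, and from [b] on it is the constant 1. *)
Lemma unimodal_atom_right : c = b -> unimodal Z.
Proof.
move=> cb; have [ab distE] := apuZ; exists b.
have ba0 : (0 < b - a)%R by rewrite subr_gt0.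
pose l (x : R) : R := ((x - a) / (b - a))%R.
have lconv (t x y : R) : (l (t * x + (1 - t) * y) = t * l x + (1 - t) * l y)%R.
  by rewrite /l; field; rewrite gt_eqF.
split; apply/convex_functionE => t x y t0 t1; rewrite /= !in_itv/=.
  move=> xb yb.
  have below z : (z < b)%R -> fine (cdf Z z) = (q * Num.max 0 (l z))%R.
    move=> zb; rewrite atom_plus_uniform_cdf cb leNgt zb mulr0 add0r.
    by rewrite min_r// ler_pdivrMr// mul1r lerB// ltW.
  rewrite !below ?ltr_conv//.
  have -> : (t * (q * Num.max 0 (l x)) + (1 - t) * (q * Num.max 0 (l y)) =
    q * (t * Num.max 0 (l x) + (1 - t) * Num.max 0 (l y)))%R by ring.
  have t10 : (0 <= 1 - t)%R by rewrite subr_ge0.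
  rewrite ler_wpM2l// lconv ge_max; apply/andP; split.
    by rewrite addr_ge0// mulr_ge0// le_max lexx.
  by rewrite lerD// ler_wpM2l// le_max lexx orbT.
rewrite !andbT => bx b_y.
have above z : (b <= z)%R -> fine (cdf Z z) = 1%R.
  move=> bz; rewrite atom_plus_uniform_cdf cb bz min_l; last first.
    by rewrite ler_pdivlMr// mul1r lerB.
  by rewrite max_r// !mulr1.
rewrite !above//; last by nra.
lra.
Qed.

(** Below [a] the distribution function vanishes, and from [a] on it is
    [p + q min(1, l)], with [l] affine and hence concave. *)
Lemma unimodal_atom_left : c = a -> unimodal Z.
Proof.
move=> ca; have [ab distE] := apuZ; exists a.
have ba0 : (0 < b - a)%R by rewrite subr_gt0.
pose l (x : R) : R := ((x - a) / (b - a))%R.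
have lconv (t x y : R) : (l (t * x + (1 - t) * y) = t * l x + (1 - t) * l y)%R.
  by rewrite /l; field; rewrite gt_eqF.
split; apply/convex_functionE => t x y t0 t1; rewrite /= !in_itv/=.
  move=> xa ya.
  have below z : (z < a)%R -> fine (cdf Z z) = 0%R.
    move=> za; rewrite atom_plus_uniform_cdf ca leNgt za mulr0 add0r.
    rewrite max_l ?mulr0//.
    by rewrite ge_min pmulr_lle0 ?invr_gt0// subr_le0 (ltW za) orbT.
  rewrite !below ?ltr_conv//.
  by rewrite !mulr0 addr0.
rewrite !andbT => ax ay.
have above z : (a <= z)%R -> fine (cdf Z z) = (p + q * Num.min 1 (l z))%R.
  move=> az; rewrite atom_plus_uniform_cdf ca az mulr1.
  rewrite max_r// le_min ler01/= divr_ge0 ?(ltW ba0)//.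
  by rewrite subr_ge0.
rewrite !above//; last by nra.
have t10 : (0 <= 1 - t)%R by rewrite subr_ge0.
have : (t * Num.min 1 (l x) + (1 - t) * Num.min 1 (l y) <=
        Num.min 1 (l (t * x + (1 - t) * y)))%R.
  rewrite le_min lconv; apply/andP; split.
    have := ler_wpM2l t0 (_ : Num.min 1 (l x) <= 1)%R.
    have := ler_wpM2l t10 (_ : Num.min 1 (l y) <= 1)%R.
    by rewrite !ge_min !lexx => /(_ isT) h /(_ isT); lra.
  by rewrite lerD// ler_wpM2l// ge_min lexx orbT.
move=> /(ler_wpM2l q0); lra.
Qed.
End atom_uniform.

Theorem theorem5p2 (R : realType) (d : measure_display) (T : measurableType d)
    (P : probability T R) (Z : {RV P >-> R}) (v : R) (hv : 0 <= v) :
  [/\ standardized Z -> unimodal Z ->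
        (v <= Num.sqrt (5 / 3) ->
           (P [set t | (v <= Z t)%R]
              <= ((3 - v ^+ 2) / (3 * (1 + v ^+ 2)))%:E)%E) /\
        (Num.sqrt (5 / 3) <= v ->
           (P [set t | (v <= Z t)%R] <= (4 / 9 * (1 / (1 + v ^+ 2)))%:E)%E),
      0 < v -> v <= Num.sqrt (5 / 3) ->
        atom_plus_uniform Z
          ((3 - v ^+ 2) / (3 * (1 + v ^+ 2))) v
          (4 * v ^+ 2 / (3 * (1 + v ^+ 2))) (- ((3 + v ^+ 2) / (2 * v))) v ->
        [/\ standardized Z, unimodal Z &
            P [set t | (v <= Z t)%R] = ((3 - v ^+ 2) / (3 * (1 + v ^+ 2)))%:E]
    & Num.sqrt (5 / 3) <= v ->
        atom_plus_uniform Z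
          ((3 * v ^+ 2 - 1) / (3 * (1 + v ^+ 2))) (- (1 / v))
          (4 / (3 * (1 + v ^+ 2))) (- (1 / v)) ((1 + 3 * v ^+ 2) / (2 * v)) ->
        [/\ standardized Z, unimodal Z &
            P [set t | (v <= Z t)%R] = (4 / 9 * (1 / (1 + v ^+ 2)))%:E]].
Proof.
have s53 : (0 : R) <= 5 / 3 by rewrite divr_ge0.
have small : v <= Num.sqrt (5 / 3) -> v ^+ 2 <= 5 / 3.
  by rewrite -[in X in _ -> X](sqr_sqrtr s53) ler_pXn2r// nnegrE sqrtr_ge0.
have large : Num.sqrt (5 / 3) <= v -> 5 / 3 <= v ^+ 2.
  by rewrite -[in X in _ -> X](sqr_sqrtr s53) ler_pXn2r// nnegrE sqrtr_ge0.
have n0 : 0 < 1 + v ^+ 2 by rewrite ltr_pwDl// sqr_ge0.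
have n_neq0 : 1 + v ^+ 2 != 0 by rewrite gt_eqF.
split.
- move=> sZ uZ; have [le1 le2] := unimodal_tail_le hv sZ uZ.
  by split=> [/small|/large].
- move=> v0 /small v53 apu; have v_neq0 : v != 0 by rewrite gt_eqF.
  have p0 : 0 <= (3 - v ^+ 2) / (3 * (1 + v ^+ 2)).
    by rewrite divr_ge0 ?mulr_ge0 ?(ltW n0)//; lra.
  have q0 : 0 <= 4 * v ^+ 2 / (3 * (1 + v ^+ 2)).
    by rewrite divr_ge0 ?mulr_ge0 ?sqr_ge0 ?(ltW n0).
  have pq1 : (3 - v ^+ 2) / (3 * (1 + v ^+ 2)) +
      4 * v ^+ 2 / (3 * (1 + v ^+ 2)) = 1 by field.
  split.
  + by apply: (atom_plus_uniform_standardized p0 q0 pq1 apu); field;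
      rewrite ?n_neq0 ?v_neq0.
  + exact: (unimodal_atom_right q0 pq1 apu (erefl v)).
  + have [ab _] := apu; rewrite (atom_plus_uniform_tail apu (ltW ab) (lexx v)).
    by rewrite lexx subrr mul0r mulr0 addr0 mulr1.
- move=> /[dup] sv /large v53 apu.
  have v0 : 0 < v by apply: lt_le_trans sv; rewrite sqrtr_gt0 divr_gt0.
  have v_neq0 : v != 0 by rewrite gt_eqF.
  have p0 : 0 <= (3 * v ^+ 2 - 1) / (3 * (1 + v ^+ 2)).
    by rewrite divr_ge0 ?mulr_ge0 ?(ltW n0)//; lra.
  have q0 : 0 <= 4 / (3 * (1 + v ^+ 2)).
    by rewrite divr_ge0 ?mulr_ge0 ?(ltW n0).
  have pq1 : (3 * v ^+ 2 - 1) / (3 * (1 + v ^+ 2)) +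
      4 / (3 * (1 + v ^+ 2)) = 1 by field.
  have cv : - (1 / v) < v by rewrite (lt_trans _ v0)// oppr_lt0 divr_gt0.
  have vb : v <= (1 + 3 * v ^+ 2) / (2 * v).
    by rewrite ler_pdivlMr ?mulr_gt0//; nra.
  split.
  + by apply: (atom_plus_uniform_standardized p0 q0 pq1 apu); field;
      rewrite ?n_neq0 ?v_neq0.
  + exact: (unimodal_atom_left q0 apu (erefl _)).
  + rewrite (atom_plus_uniform_tail apu (ltW cv) vb).
    rewrite leNgt cv mulr0 add0r; congr EFin; field.
    by rewrite v_neq0 n_neq0/= gt_eqF//; nra.
Qed.
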